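(* Let $0\le k\le n$ be integers. Every hereditary $k$-fold banned binary sequence problem $f$ of length $n$ has at most $\sum_{i=0}^{k-1}\binom{n}{i}$ solutions.
   Context: Write $[n]=\{0,1,\dots,n-1\}$ and let $\binom{[n]}{k}$ denote the collection of subsets of $[n]$ of size $k$. Binary sequences are viewed as functions from a set of indices to $\{0,1\}$. A $k$-fold banned binary sequence problem (BBSP) of length $n$ is a function $f:\binom{[n]}{k}\times 2^{n-k}\to\mathcal{P}(2^k)\setminus\{\emptyset\}$. Precisely: for each $S\in\binom{[n]}{k}$ and each function $X:[n]\setminus S\to\{0,1\}$, $f(S,X)$ is a nonempty set of functions $Z:S\to\{0,1\}$. For binary sequences $X,Y$ with disjoint domains, $X\wedge Y$ denotes their union (as functions). A solution to $f$ is a function $X:[n]\to\{0,1\}$ such that for every $S\in\binom{[n]}{k}$, $X|_S\notin f(S,X|_{[n]\setminus S})$. $f$ is not hereditary if there are $S\in\binom{[n]}{k}$ and a choice, for each function $Z_\alpha:S\to\{0,1\}$, of a function $X_\alpha:[n]\setminus S\to\{0,1\}$ such that $Z_\alpha\notin f(S,X_\alpha)$ for every $\alpha$ and, whenever $Z_\alpha\ne Z_\beta$, the first (smallest) index at which $X_\alpha\wedge Z_\alpha$ and $X_\beta\wedge Z_\beta$ differ belongs to $S$. Otherwise $f$ is hereditary. *)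

(* Defs.v *)
From HB Require Import structures.
From mathcomp Require Import all_boot.

Set Implicit Arguments.
Unset Strict Implicit.
Unset Printing Implicit Defensive.

Definition ksubset (n k : nat) := {S : {set 'I_n} | #|S| == k}.

Notation bseq S := {ffun {i | i \in S} -> bool}.
Notation fullseq n := {ffun 'I_n -> bool}.

Definition restr (n : nat) (S : {set 'I_n}) (X : fullseq n) : bseq S :=
  [ffun i => X (val i)].

(* X /\ Z, the union of two functions with complementary domains; the last
   branch is never reached, since every i lies in S or in ~: S. *)
Definition join (n : nat) (S : {set 'I_n})
    (X : bseq (~: S)) (Z : bseq S) : fullseq n :=
  [ffun i => if insub i is Some j then Z j
             else if insub i is Some j then X j else false].

Record bbsp (n k : nat) := Bbsp {
  banned :> forall S : ksubset n k, bseq (~: val S) -> {set bseq (val S)};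
  banned_neq0 : forall S X, @banned S X != set0
}.

Arguments banned {n k} f S X : rename.

Definition is_solution (n k : nat) (f : bbsp n k) (X : fullseq n) : bool :=
  [forall S : ksubset n k,
     restr (val S) X \notin f S (restr (~: val S) X)].

Definition solutions (n k : nat) (f : bbsp n k) : {set fullseq n} :=
  [set X | is_solution f X].

Definition first_diff_in (n : nat) (S : {set 'I_n}) (X Y : fullseq n) : Prop :=
  exists i : 'I_n,
    [/\ i \in S, X i != Y i & forall j : 'I_n, j < i -> X j = Y j].

Definition not_hereditary (n k : nat) (f : bbsp n k) : Prop :=
  exists (S : ksubset n k) (X : bseq (val S) -> bseq (~: val S)),
    (forall Z, Z \notin f S (X Z)) /\
    (forall Z Z', Z != Z' ->
       first_diff_in (val S) (join (X Z) Z) (join (X Z') Z')).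

Definition hereditary (n k : nat) (f : bbsp n k) : Prop := ~ not_hereditary f.

Lemma join_restr (n : nat) (S : {set 'I_n}) (X : fullseq n) :
  join (restr (~: S) X) (restr S X) = X.
Proof.
apply/ffunP=> i; rewrite ffunE; case: insubP => [j _ <-|iS]; rewrite ?ffunE //.
by case: insubP => [j _ <-|]; rewrite ?ffunE // inE iS.
Qed.

Lemma restr_join (n : nat) (S : {set 'I_n}) (X : bseq (~: S)) (Z : bseq S) :
  restr S (join X Z) = Z /\ restr (~: S) (join X Z) = X.
Proof.
split; apply/ffunP=> i; rewrite !ffunE; first by rewrite valK.
case: insubP => [j jS|_]; last by rewrite valK.
by have := valP i; rewrite inE jS.
Qed.

(* Main.v *)
Require Import Defs.
From HB Require Import structures.
From mathcomp Require Import all_boot.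

(** The proof is an ordered form of the Sauer-Shelah argument. Say that a
    family [F] of binary sequences order-shatters [S] when some subfamily [G]
    of [F] realizes every pattern on [S] while any two members of [G] first
    differ inside [S]. Members of [G] then correspond one-to-one to patterns
    on [S], and if [F] consists of solutions, each member of [G], being a
    solution, avoids the ban on its pattern; so [G] is exactly a witness that
    the problem is not hereditary ([shattered_not_hereditary]). Hence the
    solutions of a hereditary problem order-shatter no set of size [k], and,
    since order-shattering passes to subsets ([shatteredS]), only sets of size
    less than [k].

    It remains to see that a family order-shatters at least as many sets as it
    has members ([card_le_shattered]). Split [F] by the value at the first
    coordinate [i] into [F0] and [F1]. A set of later coordinates shattered by
    either half is shattered by [F]; if it is shattered by both halves, then
    adding [i] to it gives another set shattered by [F], because sequences
    from different halves first differ at [i]. Since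
    [#|A :|: B| + #|A :&: B| = #|A| + #|B|], the induction closes. *)

Section OrderShattering.

Set Implicit Arguments.
Unset Strict Implicit.

Variable n : nat.
Implicit Types (F G : {set fullseq n}) (S T : {set 'I_n}) (X Y Z : fullseq n).

Definition first_diffb S X Y : bool :=
  [exists i in S, (X i != Y i) && [forall j : 'I_n, (j < i) ==> (X j == Y j)]].

Lemma first_diffP S X Y : reflect (first_diff_in S X Y) (first_diffb S X Y).
Proof.
apply: (iffP exists_inP) => [[i iS /andP[ne /forall_inP eqXY]]|[i [iS ne eqXY]]].
  by exists i; split=> // j /eqXY/eqP.
by exists i; rewrite // ne; apply/forall_inP => j /eqXY ->.
Qed.

Definition branches_in S G : bool :=
  [forall Z : fullseq n, exists X in G, [forall i in S, X i == Z i]] &&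
  [forall X in G, forall Y in G, (X != Y) ==> first_diffb S X Y].

Lemma branches_inP S G :
  reflect ((forall Z, exists2 X, X \in G & {in S, X =1 Z}) /\
           {in G &, forall X Y, X != Y -> first_diff_in S X Y})
          (branches_in S G).
Proof.
apply: (iffP andP) => [[/forallP onto /forall_inP sep]|[onto sep]]; split.
- move=> Z; have /exists_inP[X XG /forall_inP XZ] := onto Z.
  by exists X => // i /XZ/eqP.
- move=> X Y /sep/forall_inP sepX /sepX/implyP sepXY /sepXY.
  exact: first_diffP.
- apply/forallP => Z; have [X XG XZ] := onto Z.
  by apply/exists_inP; exists X => //; apply/forall_inP => i /XZ ->.
- apply/forall_inP => X XG; apply/forall_inP => Y YG; apply/implyP => ne.
  exact/first_diffP/sep.
Qed.

Definition shattered F : {set {set 'I_n}} :=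
  [set S | [exists G : {set fullseq n}, (G \subset F) && branches_in S G]].

Lemma shatteredP F S :
  reflect (exists2 G : {set fullseq n}, G \subset F & branches_in S G) (S \in shattered F).
Proof.
rewrite inE; apply: (iffP existsP) => [[G /andP[]]|[G GF GS]]; exists G => //.
exact/andP.
Qed.

Lemma shattered_mono F F' : F \subset F' -> shattered F \subset shattered F'.
Proof.
move=> sFF'; apply/subsetP => S /shatteredP[G sGF GS]; apply/shatteredP.
by exists G; rewrite // (subset_trans sGF).
Qed.

(** Keep only the members of the witness that vanish on [S :\: T]: where two of
    them first differ, which lies in [S], they cannot both vanish, so that
    index lies in [T]. *)
Lemma shatteredS F S T : T \subset S -> S \in shattered F -> T \in shattered F.
Proof.
move=> sTS /shatteredP[G sGF /branches_inP[onto sep]]; apply/shatteredP.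
exists [set X in G | [forall i in S :\: T, ~~ X i]].
  by apply: subset_trans sGF; apply/subsetP => X; rewrite inE => /andP[].
apply/branches_inP; split=> [Z|X Y].
  have [X XG XZ] := onto [ffun i => (i \in T) && Z i].
  exists X => [|i iT]; last by rewrite XZ ?ffunE ?iT ?(subsetP sTS).
  rewrite inE XG; apply/forall_inP => i; rewrite inE => /andP[iT iS].
  by rewrite XZ // ffunE (negPf iT).
rewrite !inE => /andP[XG /forall_inP X0] /andP[YG /forall_inP Y0] ne.
have [i [iS neXY eqXY]] := sep _ _ XG YG ne; exists i; split=> //.
apply/negPn/negP => iT; have iST : i \in S :\: T by rewrite inE iT.
by move: neXY; rewrite (negPf (X0 _ iST)) (negPf (Y0 _ iST)).
Qed.

(** Two sequences of different halves of [F] first differ at [i], so the union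
    of witnesses for the two halves branches in [i |: S]. *)
Lemma shatteredU1 F S (i : 'I_n) :
    {in F &, forall X Y (j : 'I_n), j < i -> X j = Y j} ->
    (forall b, S \in shattered [set X in F | X i == b]) ->
  i |: S \in shattered F.
Proof.
move=> agree shS.
have /shatteredP[G1 /subsetP sG1 /branches_inP[onto1 sep1]] := shS true.
have /shatteredP[G0 /subsetP sG0 /branches_inP[onto0 sep0]] := shS false.
have G1P X : X \in G1 -> X \in F /\ X i = true.
  by move/sG1; rewrite inE => /andP[? /eqP].
have G0P X : X \in G0 -> X \in F /\ X i = false.
  by move/sG0; rewrite inE => /andP[? /eqP].
have wide X Y : first_diff_in S X Y -> first_diff_in (i |: S) X Y.
  by case=> j [jS ne eqXY]; exists j; rewrite inE jS orbT.
have at_i X Y : X \in F -> Y \in F -> X i != Y i -> first_diff_in (i |: S) X Y.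
  by move=> XF YF ne; exists i; rewrite setU11; split=> // j; apply: agree.
apply/shatteredP; exists (G0 :|: G1).
  by apply/subsetP => X; rewrite inE => /orP[/G0P[]|/G1P[]].
apply/branches_inP; split=> [Z|X Y].
  case Zi: (Z i).
    have [X XG XZ] := onto1 Z; exists X; first by rewrite inE XG orbT.
    by move=> j /setU1P[->|/XZ //]; rewrite Zi; case: (G1P _ XG).
  have [X XG XZ] := onto0 Z; exists X; first by rewrite inE XG.
  by move=> j /setU1P[->|/XZ //]; rewrite Zi; case: (G0P _ XG).
rewrite !inE => /orP[] XG /orP[] YG ne.
- exact/wide/sep0.
- have [[XF Xi] [YF Yi]] := (G0P _ XG, G1P _ YG).
  by apply: at_i; rewrite ?Xi ?Yi.
- have [[XF Xi] [YF Yi]] := (G1P _ XG, G0P _ YG).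
  by apply: at_i; rewrite ?Xi ?Yi.
- exact/wide/sep1.
Qed.

Definition shattered_from F d : {set {set 'I_n}} :=
  [set S in shattered F | [forall i in S, d <= i]].

(** Instead of shortening the sequences, the induction lets the members of [F]
    agree on a longer and longer prefix, and counts the shattered sets that
    avoid this prefix. *)
Lemma card_le_shattered_from F d :
    {in F &, forall X Y (j : 'I_n), j < d -> X j = Y j} ->
  #|F| <= #|shattered_from F d|.
Proof.
have [m] := ubnP (n - d); elim: m => // m IHm in F d *.
rewrite ltnS => le_m agree; have [le_nd|lt_dn] := leqP n d.
  have [->|[X XF]] := set_0Vmem F; first by rewrite cards0.
  have FX : F \subset [set X].
    apply/subsetP => Y YF; rewrite inE; apply/eqP/ffunP => j.
    by apply: agree => //; apply: leq_trans le_nd.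
  apply: leq_trans (subset_leq_card FX) _; rewrite cards1 card_gt0.
  apply/set0Pn; exists set0; rewrite inE; apply/andP; split; last first.
    by apply/forall_inP => i; rewrite inE.
  apply/shatteredP; exists [set X]; first by rewrite sub1set.
  apply/branches_inP; split=> [Z|Y Y' /set1P-> /set1P->]; last by rewrite eqxx.
  by exists X => [|i]; rewrite inE.
pose i := Ordinal lt_dn; pose H b := [set X in F | X i == b].
pose A b := shattered_from (H b) d.+1.
have sHF b : H b \subset F by apply/subsetP => X; rewrite inE => /andP[].
have cardH b : #|H b| <= #|A b|.
  apply: IHm => [|X Y]; first by rewrite subnS prednK ?subn_gt0.
  rewrite !inE => /andP[XF /eqP Xi] /andP[YF /eqP Yi] j.
  rewrite ltnS leq_eqVlt => /orP[/eqP ji|]; last exact: agree.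
  by rewrite (_ : j = i) ?Xi ?Yi //; apply: val_inj.
have cardF : #|F| = #|H true| + #|H false|.
  rewrite -(cardsID [set X : fullseq n | X i]); congr (_ + _); apply: eq_card => X.
    by rewrite !inE; case: (X i).
  by rewrite !inE; case: (X i); rewrite ?andbT ?andbF.
have A_notin b S : S \in A b -> i \notin S.
  rewrite inE => /andP[_ /forall_inP geS].
  by apply/negP => /geS; rewrite /= ltnn.
have A_from b S : S \in A b -> S \in shattered_from F d.
  rewrite inE => /andP[shS /forall_inP geS]; rewrite inE; apply/andP; split.
    exact: (subsetP (shattered_mono (sHF b))).
  by apply/forall_inP => j /geS/ltnW.
pose B := [set i |: S | S in A true :&: A false].
have cardB : #|B| = #|A true :&: A false|.
  apply: card_in_imset => S T /setIP[/A_notin iS _] /setIP[/A_notin iT _] eqST.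
  by rewrite -(setU1K iS) eqST setU1K.
have disj : [disjoint A true :|: A false & B].
  rewrite disjoint_subset; apply/subsetP => S SA; rewrite inE.
  apply/imsetP => -[T _ eqS].
  have: i \notin S by case/setUP: SA => /A_notin.
  by rewrite eqS setU11.
rewrite cardF (leq_trans (leq_add (cardH _) (cardH _))) // -cardsUI -cardB.
rewrite -(eqTleqif (leq_card_setU _ _) disj); apply/subset_leq_card/subsetP => S.
case/setUP=> [/setUP[]|/imsetP[T /setIP[TA1 TA0] ->]]; try exact: A_from.
rewrite inE; apply/andP; split; last first.
  have := A_from _ _ TA1; rewrite inE => /andP[_ /forall_inP geT].
  by apply/forall_inP => j /setU1P[->|/geT].
apply: shatteredU1 => // b.
by case: b; [move: TA1 | move: TA0]; rewrite inE => /andP[].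
Qed.

Lemma card_le_shattered F : #|F| <= #|shattered F|.
Proof.
apply: leq_trans (@card_le_shattered_from F 0 _) _ => //.
by apply/subset_leq_card/subsetP => S; rewrite inE => /andP[].
Qed.

End OrderShattering.

Lemma card_sets_lt (T : finType) k :
  #|[set S : {set T} | #|S| < k]| = \sum_(0 <= i < k) 'C(#|T|, i).
Proof.
elim: k => [|k IHk]; first by rewrite big_geq // eq_card0 // => S; rewrite inE.
rewrite big_nat_recr //= -IHk -card_draws -cardsUI.
rewrite (_ : _ :&: _ = set0) ?cards0 ?addn0.
  by apply: eq_card => S; rewrite !inE ltnS leq_eqVlt orbC.
by apply/setP => S; rewrite !inE; case: ltngtP.
Qed.

(** Assign to each pattern on [S] the part outside [S] of the witness member
    realizing it: no ban applies, as that member is a solution. *)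
Lemma shattered_not_hereditary n k (f : bbsp n k) (S : ksubset n k) :
  val S \in shattered (solutions f) -> not_hereditary f.
Proof.
case/shatteredP=> G /subsetP sG /branches_inP[onto sep].
have ex (Z : {ffun {i | i \in val S} -> bool}) : exists X, X \in G /\ restr (val S) X = Z.
  (* Patterns in [branches_in] are full sequences: pad [Z] arbitrarily. *)
  have [X XG XZ] := onto (join [ffun => false] Z); exists X; split=> //.
  rewrite -[RHS](restr_join [ffun => false] Z).1.
  by apply/ffunP => i; rewrite !ffunE XZ ?ffunE //; apply: valP.
have [g gP] := fin_all_exists ex.
have gK Z : join (restr (~: val S) (g Z)) Z = g Z.
  by have [_ {2}<-] := gP Z; rewrite join_restr.
exists S, (fun Z => restr (~: val S) (g Z)); split=> [Z|Z Z' ne].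
  have [/sG + eqZ] := gP Z; rewrite inE => /forallP/(_ S).
  by rewrite eqZ.
rewrite !gK; have [[gG eqZ] [gG' eqZ']] := (gP Z, gP Z').
by apply: sep => //; apply: contra_neq ne => eqg; rewrite -eqZ -eqZ' eqg.
Qed.

Theorem theorem3p7 (n k : nat) (hkn : k <= n) (f : bbsp n k)
    (hf : hereditary f) :
  #|solutions f| <= \sum_(0 <= i < k) 'C(n, i).
Proof.
apply: leq_trans (card_le_shattered _) _.
have := card_sets_lt 'I_n k; rewrite card_ord => <-.
apply/subset_leq_card/subsetP => S shS; rewrite inE ltnNge.
apply/negP => leS; apply: hf.
have [T [sTS cT]] : exists T : {set 'I_n}, T \subset S /\ #|T| == k.
  have /set0Pn[T] : [set T : {set 'I_n} | T \subset S & #|T| == k] != set0.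
    by rewrite -card_gt0 cards_draws bin_gt0.
  by rewrite inE => /andP[]; exists T.
apply: (@shattered_not_hereditary _ _ _ (exist _ T cT)).
exact: shatteredS sTS shS.
Qed.
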